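(* Let $B$ be a bialgebra over a field $\Bbbk$ and consider the coinvariant functor $(-)^{\mathrm{co}B}:\mathfrak{M}_B^B\to\mathfrak{M}$. The following assertions are equivalent. (1) $(-)^{\mathrm{co}B}$ is semiseparable. (2) $B$ is a right Hopf algebra with anti-multiplicative and anti-comultiplicative right antipode. (3) The canonical natural transformation $\sigma:(-)^{\mathrm{co}B}\to\overline{(-)}^B$ is invertible. (4) The canonical natural transformation $\sigma:(-)^{\mathrm{co}B}\to\overline{(-)}^B$ is split-mono.
   Context: $\mathfrak{M}$ is the category of $\Bbbk$-vector spaces; $\mathfrak{M}_B^B$ is the category of right Hopf modules over $B$: right $B$-modules $M$ which are right $B$-comodules via $\rho_M:M\to M\otimes B$, $m\mapsto\sum m_0\otimes m_1$, with $\rho_M(mb)=\sum m_0b_1\otimes m_1b_2$; morphisms are $B$-linear $B$-colinear maps. $M^{\mathrm{co}B}=\{m\in M\mid\rho_M(m)=m\otimes1_B\}$; $\overline{M}^B=M/MB^+$ where $B^+=\ker(\varepsilon_B)$; both define functors $\mathfrak{M}_B^B\to\mathfrak{M}$. The canonical natural transformation $\sigma$ has components $\sigma_M:M^{\mathrm{co}B}\to\overline{M}^B$, $m\mapsto m+MB^+$. It is split-mono if there is a natural transformation $\tau:\overline{(-)}^B\to(-)^{\mathrm{co}B}$ with $\tau\circ\sigma=\mathrm{Id}$. A right Hopf algebra is a bialgebra $B$ with a right antipode, i.e. a $\Bbbk$-linear map $S_B:B\to B$ with $\sum x_1S_B(x_2)=\varepsilon_B(x)1_B$ for all $x\in B$;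 condition (2) asks for the existence of a right antipode that is an anti-multiplicative ($S_B(xy)=S_B(y)S_B(x)$) and anti-comultiplicative ($\Delta(S_B(x))=\sum S_B(x_2)\otimes S_B(x_1)$) map. For a functor $F:\mathcal{C}\to\mathcal{D}$ let $\mathcal{F}^F:\mathrm{Hom}_{\mathcal{C}}(-,-)\to\mathrm{Hom}_{\mathcal{D}}(F-,F-)$ be the natural transformation (of functors $\mathcal{C}^{\mathrm{op}}\times\mathcal{C}\to\mathsf{Set}$) with $\mathcal{F}^F_{X,Y}(f)=F(f)$. $F$ is semiseparable if there is a natural transformation $\mathcal{P}^F:\mathrm{Hom}_{\mathcal{D}}(F-,F-)\to\mathrm{Hom}_{\mathcal{C}}(-,-)$ with $\mathcal{F}^F\circ\mathcal{P}^F\circ\mathcal{F}^F=\mathcal{F}^F$. *)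

(* Defs.v *)
From HB Require Import structures.
From mathcomp Require Import all_boot all_algebra.
From mathcomp Require Import boolp.
From mathcomp.multinomials Require Import freeg.

Set Implicit Arguments.
Unset Strict Implicit.
Unset Printing Implicit Defensive.

Import GRing.Theory.
Import Quotient.

Local Open Scope ring_scope.
Local Open Scope quotient_scope.

Section LinearExt.
Variables (K : fieldType) (U V : lmodType K).

Lemma linear_ext (f g : {linear U -> V}) : f =1 g -> f = g.
Proof.
case: f => f [[a] [b]]; case: g => g [[a'] [b']] /= /funext fg.
move: a b a' b'; rewrite fg => a b a' b'.
by rewrite (Prop_irrelevance a a') (Prop_irrelevance b b').
Qed.

End LinearExt.

Section Span.
Variables (K : fieldType) (V : lmodType K).

Inductive in_lspan (G : V -> Prop) : V -> Prop :=
| in_lspan0 : in_lspan G 0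
| in_lspan_gen x : G x -> in_lspan G x
| in_lspanZD a x y : in_lspan G x -> in_lspan G y -> in_lspan G (a *: x + y).

Definition lspan (G : V -> Prop) : {pred V} := fun x => `[< in_lspan G x >].

Lemma lspan_submod_closed G : submod_closed (lspan G).
Proof.
split; first by apply/asboolP; exact: in_lspan0.
by move=> a x y /asboolP xG /asboolP yG; apply/asboolP; exact: in_lspanZD.
Qed.

HB.instance Definition _ G :=
  GRing.isSubmodClosed.Build K V (lspan G) (lspan_submod_closed G).

Lemma mem_lspan (G : V -> Prop) x : G x -> x \in lspan G.
Proof. by move=> Gx; apply/asboolP; exact: in_lspan_gen. Qed.

Lemma lspan_ker (W : lmodType K) (f : {linear V -> W}) (G : V -> Prop) :
  (forall x, G x -> f x = 0) -> forall x, x \in lspan G -> f x = 0.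
Proof.
move=> fG x /asboolP; elim=> {x} [|x /fG//|a x y _ fx _ fy].
  exact: linear0.
by rewrite linearP fx fy scaler0 addr0.
Qed.

End Span.

(* The quotient of V by the subspace spanned by G. *)
Section QuotientSpace.
Variables (K : fieldType) (V : lmodType K) (G : V -> Prop).

Definition qspace := {quot (lspan G)}.

HB.instance Definition _ := Choice.on qspace.
HB.instance Definition _ := GRing.Zmodule.on qspace.

Definition qproj (x : V) : qspace := \pi_({quot (lspan G)}) x.

Lemma qproj_eq x y : (qproj x == qproj y) = (x - y \in lspan G).
Proof. by rewrite /qproj idealrBE. Qed.

Lemma qproj_surj (t : qspace) : exists x, t = qproj x.
Proof. by exists (repr (t : {quot (lspan G)})); rewrite /qproj reprK. Qed.

Definition qscale (a : K) (t : qspace) : qspace :=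
  qproj (a *: repr (t : {quot (lspan G)})).

Lemma qscale_qproj a x : qscale a (qproj x) = qproj (a *: x).
Proof.
apply/eqP; rewrite qproj_eq -scalerBr rpredZ // -qproj_eq.
by rewrite /qproj reprK.
Qed.

Let qprojD x y : qproj (x + y) = qproj x + qproj y.
Proof. by rewrite /qproj raddfD. Qed.

Lemma qscaleA a b t : qscale a (qscale b t) = qscale (a * b) t.
Proof. by have [x ->] := qproj_surj t; rewrite !qscale_qproj scalerA. Qed.

Lemma qscale1 : left_id 1 qscale.
Proof. by move=> t; have [x ->] := qproj_surj t; rewrite qscale_qproj scale1r. Qed.

Lemma qscaleDr : right_distributive qscale +%R.
Proof.
move=> a s t; have [[x ->] [y ->]] := (qproj_surj s, qproj_surj t).
by rewrite -qprojD !qscale_qproj scalerDr qprojD.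
Qed.

Lemma qscaleDl t : {morph qscale^~ t : a b / a + b}.
Proof.
by move=> a b; have [x ->] := qproj_surj t; rewrite !qscale_qproj scalerDl qprojD.
Qed.

HB.instance Definition _ :=
  GRing.Zmodule_isLmodule.Build K qspace qscaleA qscale1 qscaleDr qscaleDl.

Lemma qproj_is_linear : linear qproj.
Proof. by move=> a x y; rewrite qprojD -qscale_qproj. Qed.

HB.instance Definition _ :=
  GRing.isLinear.Build K V qspace _ qproj qproj_is_linear.

Definition qlift (W : Type) (f : V -> W) (t : qspace) : W :=
  f (repr (t : {quot (lspan G)})).

Section Lift.
Variables (W : lmodType K) (f : {linear V -> W}).
Hypothesis fG : forall x, G x -> f x = 0.

Lemma qliftE x : qlift f (qproj x) = f x.
Proof.
apply/eqP; rewrite -subr_eq0 -linearB (lspan_ker fG) // -qproj_eq.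
by rewrite /qproj reprK.
Qed.

Lemma qlift_is_linear : linear (qlift f).
Proof.
move=> a s t; have [[x ->] [y ->]] := (qproj_surj s, qproj_surj t).
by rewrite -linearP !qliftE linearP.
Qed.

End Lift.

End QuotientSpace.

Section FreeModule.
Variables (K : fieldType) (T : choiceType) (W : lmodType K) (f : T -> W).

Lemma fglift_is_linear : linear (fglift f : {freeg T / K} -> W).
Proof.
have fB := @lift_is_additive K T W f.
have f0 : fglift f 0 = 0 by rewrite -(subrr 0) fB subrr.
have fD x y : fglift f (x + y) = fglift f x + fglift f y.
  by rewrite -{1}(opprK y) fB -(add0r (- y)) fB f0 sub0r opprK.
move=> a x y; rewrite fD; congr (_ + _); elim/freeg_ind_dom0: x => [|k t D _ _ IH].
  by rewrite scaler0 f0 scaler0.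
rewrite scalerDr !fD IH scalerDr; congr (_ + _).
have -> : a *: << k *g t >> = << a * k *g t >>.
  by apply/eqP/freeg_eqP => x; rewrite coeffZ !coeffU mulrA.
by rewrite !liftU scalerA.
Qed.

HB.instance Definition _ :=
  GRing.isLinear.Build K {freeg T / K} W _ (fglift f) fglift_is_linear.

End FreeModule.

Notation bilinear_map f := (bilinear_for *:%R *:%R f).

Section Tensor.
Variable K : fieldType.
Section Def.
Variables M N : lmodType K.

Local Notation free := {freeg (M * N)%type / K}.
Local Notation e m n := (<< (m, n) >> : free).

(* M ⊗ N is the free vector space on M * N modulo the bilinearity relations. *)
Inductive tensor_rel : free -> Prop :=
| tensor_rel_l a m m' n : tensor_rel (e (a *: m + m') n - (a *: e m n + e m' n))
| tensor_rel_r a m n n' : tensor_rel (e m (a *: n + n') - (a *: e m n + e m n')).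

Definition tensor := qspace tensor_rel.
HB.instance Definition _ := GRing.Lmodule.on tensor.

Definition tens (m : M) (n : N) : tensor := qproj tensor_rel (e m n).

Lemma tens_bilinear : bilinear_map tens.
Proof.
have qE a x y : a *: qproj tensor_rel x + qproj tensor_rel y =
    qproj tensor_rel (a *: x + y) by rewrite linearP.
split=> [n a m m'|m a n n']; apply/eqP; rewrite qE qproj_eq; apply: mem_lspan.
- exact: tensor_rel_l.
- exact: tensor_rel_r.
Qed.

HB.instance Definition _ :=
  bilinear_isBilinear.Build K M N tensor *:%R *:%R tens tens_bilinear.

Lemma tens_ind (P : tensor -> Prop) :
  P 0 -> (forall m n t, P t -> P (tens m n + t)) -> forall t, P t.
Proof.
move=> P0 PD t; have [x ->] := qproj_surj t.
elim/freeg_ind_dom0: x => [|k [m n] D _ _ IH]; first by rewrite linear0.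
rewrite linearD; have -> : << k *g (m, n) >> = k *: e m n.
  by apply/eqP/freeg_eqP => x; rewrite coeffZ !coeffU mul1r.
rewrite linearZ /= -/(tens m n) -[k *: _](linearZl_LR (tens)) /=.
exact: PD.
Qed.

End Def.
Section Lift.
Variables (M N P : lmodType K) (f : M -> N -> P).

(* The linear map tens m n |-> f m n; a junk value unless f is bilinear. *)
Definition tlift : tensor M N -> P :=
  @qlift K _ (@tensor_rel M N) P (fglift (fun p : M * N => f p.1 p.2)).

Hypothesis fB : bilinear_map f.

Let tlift_rel x : @tensor_rel M N x -> fglift (fun p : M * N => f p.1 p.2) x = 0.
Proof.
case=> [a m m' n|a m n n']; rewrite linearB linearP /= !liftU /= !scale1r.
- by rewrite fB.1 subrr.
- by rewrite fB.2 subrr.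
Qed.

Lemma tliftE m n : tlift (tens m n) = f m n.
Proof. by rewrite /tlift /tens (qliftE tlift_rel) /= liftU scale1r. Qed.

Lemma tlift_is_linear : linear tlift.
Proof. exact: (qlift_is_linear tlift_rel). Qed.

Lemma tlift0 : tlift 0 = 0.
Proof. by have := tlift_is_linear (-1) 0 0; rewrite scaler0 addr0 scaleN1r addNr. Qed.

Lemma tliftD s t : tlift (s + t) = tlift s + tlift t.
Proof. by have := tlift_is_linear 1 s t; rewrite !scale1r. Qed.

End Lift.

Lemma tens_linear_ext (M N P : lmodType K) (f g : {linear tensor M N -> P}) :
  (forall m n, f (tens m n) = g (tens m n)) -> f =1 g.
Proof.
move=> fg; elim/tens_ind => [|m n t IH]; first by rewrite !linear0.
by rewrite !linearD fg IH.
Qed.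

Lemma tlift_param (L M N P : lmodType K) (f : L -> M -> N -> P) :
  (forall x, bilinear_map (f x)) -> (forall m n, linear (fun x => f x m n)) ->
  forall t, linear (fun x => tlift (f x) t).
Proof.
move=> fB fL t a x y; elim/tens_ind: t => [|m n t IH].
  by rewrite !tlift0 // scaler0 addr0.
by rewrite !tliftD // IH !tliftE // fL scalerDr addrACA.
Qed.

Definition tmap (M M' N N' : lmodType K) (f : M -> M') (g : N -> N') :
    tensor M N -> tensor M' N' :=
  tlift (fun m n => tens (f m) (g n)).

(* tens (tens m n) p |-> tens m (tens n p) *)
Definition tassoc (M N P : lmodType K) :
    tensor (tensor M N) P -> tensor M (tensor N P) :=
  tlift (fun t p => tlift (fun m n => tens m (tens n p)) t).

(* (tens m n, tens m' n') |-> tens (f m m') (g n n') *)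
Definition tmap2 (M M' P N N' Q : lmodType K)
    (f : M -> M' -> P) (g : N -> N' -> Q)
    (s : tensor M N) (t : tensor M' N') : tensor P Q :=
  tlift (fun m n => tlift (fun m' n' => tens (f m m') (g n n')) t) s.

Section MapTheory.
Variables M M' N N' P Q : lmodType K.

Lemma tens_comp_bilinear (f : M -> P) (g : N -> Q) : linear f -> linear g ->
  bilinear_map (fun m n => tens (f m) (g n)).
Proof.
move=> lf lg; split=> [n a m m'|m a n n'] /=.
- by rewrite lf (tens_bilinear P Q).1.
- by rewrite lg (tens_bilinear P Q).2.
Qed.

Lemma tmapE (f : M -> P) (g : N -> Q) : linear f -> linear g ->
  forall m n, tmap f g (tens m n) = tens (f m) (g n).
Proof. by move=> lf lg m n; rewrite /tmap tliftE //; exact: tens_comp_bilinear. Qed.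

Lemma tmap_is_linear (f : M -> P) (g : N -> Q) : linear f -> linear g ->
  linear (tmap f g).
Proof. by move=> lf lg; apply: tlift_is_linear; exact: tens_comp_bilinear. Qed.

Lemma tassoc_inner_bilinear (p : P) :
  bilinear_map (fun (m : M) (n : N) => tens m (tens n p)).
Proof.
split=> [n a m m'|m a n n'] /=; first by rewrite (tens_bilinear _ _).1.
by rewrite (tens_bilinear _ _).1 (tens_bilinear _ _).2.
Qed.

Lemma tassoc_bilinear : bilinear_map (fun (t : tensor M N) (p : P) =>
  tlift (fun m n => tens m (tens n p)) t).
Proof.
split=> [p|t].
  exact: (tlift_is_linear (tassoc_inner_bilinear p)).
apply: (tlift_param tassoc_inner_bilinear) => m n a p p' /=.
by rewrite !(tens_bilinear _ _).2.
Qed.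

Lemma tassocE (m : M) (n : N) (p : P) :
  tassoc (tens (tens m n) p) = tens m (tens n p).
Proof.
rewrite /tassoc (tliftE tassoc_bilinear).
exact: (tliftE (tassoc_inner_bilinear p)).
Qed.

Lemma tassoc_is_linear : linear (@tassoc M N P).
Proof. exact: tlift_is_linear tassoc_bilinear. Qed.

End MapTheory.

Lemma tmap_id (M N : lmodType K) : tmap idfun idfun =1 @idfun (tensor M N).
Proof.
elim/tens_ind => [|m n t IH].
  by rewrite /tmap (tlift0 (tens_bilinear M N)).
by rewrite /tmap (tliftD (tens_bilinear M N)) (tliftE (tens_bilinear M N)) -/(tmap _ _ _) IH.
Qed.

Lemma tmap_comp (M1 M2 M3 N1 N2 N3 : lmodType K)
    (f : {linear M1 -> M2}) (f' : {linear M2 -> M3})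
    (g : {linear N1 -> N2}) (g' : {linear N2 -> N3}) t :
  tmap f' g' (tmap f g t) = tmap (f' \o f) (g' \o g) t.
Proof.
have H := tens_comp_bilinear (linearP f) (linearP g).
have H' := tens_comp_bilinear (linearP f') (linearP g').
have HH := tens_comp_bilinear (linearP (f' \o f)) (linearP (g' \o g)).
rewrite /tmap; elim/tens_ind: t => [|m n t IH].
  by rewrite (tlift0 H) (tlift0 H') (tlift0 HH).
by rewrite (tliftD H) (tliftD H') (tliftD HH) IH (tliftE H) (tliftE H') (tliftE HH).
Qed.

Section Map2Theory.
Variables (M M' P N N' Q : lmodType K) (f : M -> M' -> P) (g : N -> N' -> Q).
Hypotheses (fB : bilinear_map f) (gB : bilinear_map g).

Let inner m n : bilinear_map (fun m' n' => tens (f m m') (g n n')).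
Proof. by apply: tens_comp_bilinear => a u v; rewrite (fB.2, gB.2). Qed.

Let outer t :
  bilinear_map (fun m n => tlift (fun m' n' => tens (f m m') (g n n')) t).
Proof.
split=> [n|m].
- apply: (tlift_param (inner^~ n)) => m' n' a x y.
  by rewrite fB.1 (tens_bilinear _ _).1.
- apply: (tlift_param (inner m)) => m' n' a x y.
  by rewrite gB.1 (tens_bilinear _ _).2.
Qed.

Lemma tmap2E m n m' n' :
  tmap2 f g (tens m n) (tens m' n') = tens (f m m') (g n n').
Proof. by rewrite /tmap2 (tliftE (outer _)) (tliftE (inner _ _)). Qed.

Lemma tmap2_bilinear : bilinear_map (tmap2 f g).
Proof.
split=> [t|s]; first exact: (tlift_is_linear (outer t)).
elim/tens_ind: s => [|m n s IH] a x y; first by rewrite /tmap2 !(tlift0 (outer _)) /= scaler0 addr0.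
rewrite /tmap2 !(tliftD (outer _)) -!/(tmap2 f g s _) IH !(tliftE (outer _)).
by rewrite (tlift_is_linear (inner m n)) /= scalerDr addrACA.
Qed.

End Map2Theory.

End Tensor.

Notation "M ⊗ N" := (tensor M N) (at level 40, left associativity).

HB.mixin Record isBialgebra (K : fieldType) B of GRing.Algebra K B := {
  comul : {linear B -> B ⊗ B};
  counit : {scalar B};
  comulA : forall x : B,
    tassoc (tmap comul idfun (comul x)) = tmap idfun comul (comul x);
  comul_counitl : forall x : B,
    tlift (fun x1 x2 : B => counit x1 *: x2) (comul x) = x;
  comul_counitr : forall x : B,
    tlift (fun x1 x2 : B => counit x2 *: x1) (comul x) = x;
  comul1 : comul 1 = tens 1 1;
  comulM : forall x y : B, comul (x * y) = tmap2 *%R *%R (comul x) (comul y);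
  counit1 : counit 1 = 1;
  counitM : forall x y : B, counit (x * y) = counit x * counit y
}.

#[short(type="bialgType")]
HB.structure Definition Bialgebra (K : fieldType) :=
  {B of isBialgebra K B & GRing.Algebra K B}.

(* The K-bilinearity of ract says that the K-structure underlying the right
   B-module M is its given one. *)
HB.mixin Record isHopfModule (K : fieldType) (B : bialgType K) M
    of GRing.Lmodule K M := {
  ract : {bilinear M -> B -> M};
  ract1 : forall m : M, ract m 1 = m;
  ractM : forall (m : M) (b c : B), ract m (b * c) = ract (ract m b) c;
  coact : {linear M -> M ⊗ B};
  coactA : forall m : M,
    tassoc (tmap coact idfun (coact m)) = tmap idfun comul (coact m);
  coact_counit : forall m : M,
    tlift (fun (m0 : M) (m1 : B) => counit m1 *: m0) (coact m) = m;
  coact_act : forall (m : M) (b : B),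
    coact (ract m b) = tmap2 ract *%R (coact m) (comul b)
}.

#[short(type="hopfModType")]
HB.structure Definition HopfModule (K : fieldType) (B : bialgType K) :=
  {M of isHopfModule K B M & GRing.Lmodule K M}.

Record category := Category {
  ob :> Type;
  hom : ob -> ob -> Type;
  cat_id : forall X, hom X X;
  cat_comp : forall X Y Z, hom Y Z -> hom X Y -> hom X Z;
  cat_compA : forall X Y Z T (h : hom Z T) (g : hom Y Z) (f : hom X Y),
    cat_comp h (cat_comp g f) = cat_comp (cat_comp h g) f;
  cat_comp1l : forall X Y (f : hom X Y), cat_comp (cat_id Y) f = f;
  cat_comp1r : forall X Y (f : hom X Y), cat_comp f (cat_id X) = f
}.
Arguments hom {c}.
Arguments cat_id {c}.

Record functor (C D : category) := Functor {
  fob :> C -> D;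
  fmap : forall X Y, hom X Y -> hom (fob X) (fob Y);
  fmap1 : forall X, fmap (cat_id X) = cat_id (fob X);
  fmapM : forall X Y Z (g : hom Y Z) (f : hom X Y),
    fmap (cat_comp g f) = cat_comp (fmap g) (fmap f)
}.

Record nat_trans (C D : category) (F G : functor C D) := NatTrans {
  nt :> forall X, hom (F X) (G X);
  nt_natural : forall X Y (f : hom X Y),
    cat_comp (nt Y) (fmap F f) = cat_comp (fmap G f) (nt X)
}.

Lemma nat_trans_ext (C D : category) (F G : functor C D) (s t : nat_trans F G) :
  (forall X, s X = t X) -> s = t.
Proof.
case: s t => [s sN] [t tN] /= st.
have {}st : s = t by apply: functional_extensionality_dep.
by rewrite -st in tN *; rewrite (Prop_irrelevance sN tN).
Qed.

Section NatTrans.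
Variables C D : category.

Program Definition nt_id (F : functor C D) : nat_trans F F :=
  @NatTrans _ _ F F (fun X => cat_id (F X)) _.
Next Obligation. by rewrite cat_comp1l cat_comp1r. Qed.

Program Definition nt_comp (F G H : functor C D)
    (t : nat_trans G H) (s : nat_trans F G) : nat_trans F H :=
  @NatTrans _ _ F H (fun X => cat_comp (t X) (s X)) _.
Next Obligation. by rewrite -cat_compA nt_natural cat_compA nt_natural cat_compA. Qed.

Definition nt_split_mono (F G : functor C D) (s : nat_trans F G) : Prop :=
  exists t : nat_trans G F, nt_comp t s = nt_id F.

Definition nt_invertible (F G : functor C D) (s : nat_trans F G) : Prop :=
  exists t : nat_trans G F, nt_comp t s = nt_id F /\ nt_comp s t = nt_id G.

End NatTrans.

Program Definition op_cat (C : category) : category :=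
  @Category C (fun X Y => @hom C Y X) (fun X => cat_id X)
    (fun X Y Z g f => cat_comp f g) _ _ _.
Next Obligation. by rewrite cat_compA. Qed.
Next Obligation. by rewrite cat_comp1r. Qed.
Next Obligation. by rewrite cat_comp1l. Qed.

Program Definition prod_cat (C D : category) : category :=
  @Category (C * D) (fun X Y => (hom X.1 Y.1 * hom X.2 Y.2)%type)
    (fun X => (cat_id X.1, cat_id X.2))
    (fun X Y Z g f => (cat_comp g.1 f.1, cat_comp g.2 f.2)) _ _ _.
Next Obligation. by rewrite !cat_compA. Qed.
Next Obligation. by rewrite !cat_comp1l. Qed.
Next Obligation. by rewrite !cat_comp1r. Qed.

Program Definition type_cat : category :=
  @Category Type (fun X Y => X -> Y) (fun X => id) (fun X Y Z g f => g \o f) _ _ _.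

Program Definition hom_functor (C : category) :
    functor (prod_cat (op_cat C) C) type_cat :=
  @Functor (prod_cat (op_cat C) C) type_cat (fun X => @hom C X.1 X.2)
    (fun X Y f h => cat_comp f.2 (cat_comp h f.1)) _ _.
Next Obligation. by apply/funext => ? /=; rewrite cat_comp1l cat_comp1r. Qed.
Next Obligation. by apply/funext => ? /=; rewrite !cat_compA. Qed.

(* (X, Y) |-> Hom_D(F X, F Y) *)
Program Definition hom_functor_along (C D : category) (F : functor C D) :
    functor (prod_cat (op_cat C) C) type_cat :=
  @Functor (prod_cat (op_cat C) C) type_cat (fun X => @hom D (F X.1) (F X.2))
    (fun X Y f h => cat_comp (fmap F f.2) (cat_comp h (fmap F f.1))) _ _.
Next Obligation. by apply/funext => ? /=; rewrite !fmap1 cat_comp1l cat_comp1r. Qed.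
Next Obligation. by apply/funext => ? /=; rewrite !fmapM !cat_compA. Qed.

Program Definition fmap_nt (C D : category) (F : functor C D) :
    nat_trans (hom_functor C) (hom_functor_along F) :=
  @NatTrans _ _ (hom_functor C) (hom_functor_along F)
    (fun X f => fmap F f) _.
Next Obligation. by apply/funext => ? /=; rewrite !fmapM. Qed.

Definition semiseparable (C D : category) (F : functor C D) : Prop :=
  exists P : nat_trans (hom_functor_along F) (hom_functor C),
    nt_comp (fmap_nt F) (nt_comp P (fmap_nt F)) = fmap_nt F.

Section HopfModules.
Variable K : fieldType.

Program Definition vect_cat : category :=
  @Category (lmodType K) (fun U V => {linear U -> V})
    (fun U => idfun) (fun U V W g f => g \o f) _ _ _.
Next Obligation. exact: linear_ext. Qed.
Next Obligation. exact: linear_ext. Qed.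
Next Obligation. exact: linear_ext. Qed.

Variable B : bialgType K.

Record hopf_hom (M N : hopfModType B) := HopfHom {
  hopf_fun :> {linear M -> N};
  hopf_act : forall (m : M) (b : B), hopf_fun (ract m b) = ract (hopf_fun m) b;
  hopf_coact : forall m : M, coact (hopf_fun m) = tmap hopf_fun idfun (coact m)
}.

Lemma hopf_hom_ext (M N : hopfModType B) (f g : hopf_hom M N) : f =1 g -> f = g.
Proof.
case: f g => [f fa fc] [g ga gc] /= /linear_ext fg.
by rewrite -fg in ga gc *; rewrite (Prop_irrelevance fa ga) (Prop_irrelevance fc gc).
Qed.

Program Definition hopf_id (M : hopfModType B) : hopf_hom M M :=
  @HopfHom M M idfun _ _.
Next Obligation. by rewrite tmap_id. Qed.

Program Definition hopf_comp (M N P : hopfModType B)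
    (g : hopf_hom N P) (f : hopf_hom M N) : hopf_hom M P :=
  @HopfHom M P (g \o f) _ _.
Next Obligation. by rewrite !hopf_act. Qed.
Next Obligation. by rewrite !hopf_coact tmap_comp. Qed.

Program Definition hopf_cat : category :=
  @Category (hopfModType B) hopf_hom hopf_id hopf_comp _ _ _.
Next Obligation. exact: hopf_hom_ext. Qed.
Next Obligation. exact: hopf_hom_ext. Qed.
Next Obligation. exact: hopf_hom_ext. Qed.

Definition coinv_pred (M : hopfModType B) : {pred M} :=
  fun m => coact m == tens m 1.
Arguments coinv_pred M : clear implicits.

Lemma coinv_submod_closed (M : hopfModType B) : submod_closed (coinv_pred M).
Proof.
split=> [|a x y /eqP xc /eqP yc]; apply/eqP; last first.
  by rewrite linearP xc yc (tens_bilinear _ _).1.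
rewrite linear0; have := (tens_bilinear M B).1 1 (-1) 0 0.
by rewrite /= scaler0 addr0 scaleN1r addNr.
Qed.

HB.instance Definition _ (M : hopfModType B) :=
  GRing.isSubmodClosed.Build K M (coinv_pred M) (coinv_submod_closed M).

Record coinv (M : hopfModType B) := Coinv {
  coinv_val :> M;
  _ : coinv_val \in coinv_pred M
}.

HB.instance Definition _ (M : hopfModType B) := [isSub for @coinv_val M].
HB.instance Definition _ (M : hopfModType B) := [Choice of coinv M by <:].
HB.instance Definition _ (M : hopfModType B) := [SubChoice_isSubLmodule of coinv M by <:].

Lemma coinvP (M : hopfModType B) (m : coinv M) : coact (val m) = tens (val m) 1.
Proof. exact/eqP/(valP m). Qed.

Lemma coinv_map_subproof (M N : hopfModType B) (f : hopf_hom M N) (m : coinv M) :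
  f (val m) \in coinv_pred N.
Proof.
apply/eqP; rewrite hopf_coact coinvP.
by rewrite (tmapE (linearP f) (linearP idfun)).
Qed.

Definition coinv_map (M N : hopfModType B) (f : hopf_hom M N) (m : coinv M) :
  coinv N := Coinv (coinv_map_subproof f m).

Lemma coinv_map_is_linear (M N : hopfModType B) (f : hopf_hom M N) : linear (coinv_map f).
Proof. by move=> a x y; apply/val_inj; rewrite /= linearP. Qed.

HB.instance Definition _ (M N : hopfModType B) (f : hopf_hom M N) :=
  GRing.isLinear.Build K (coinv M) (coinv N) _ (coinv_map f)
    (coinv_map_is_linear f).

Program Definition coinv_functor : functor hopf_cat vect_cat :=
  @Functor hopf_cat vect_cat (fun M => coinv M) (fun M N f => coinv_map f) _ _.
Next Obligation. by apply: linear_ext => m; exact: val_inj. Qed.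
Next Obligation. by apply: linear_ext => m; exact: val_inj. Qed.

(* Generators of the subspace M B^+ *)
Definition MBplus_gen (M : hopfModType B) (x : M) : Prop :=
  exists m (b : B), counit b = 0 /\ x = ract m b.
Arguments MBplus_gen M : clear implicits.

(* M / M B^+ *)
Definition bar (M : hopfModType B) := qspace (MBplus_gen M).
HB.instance Definition _ (M : hopfModType B) := GRing.Lmodule.on (bar M).

Definition bar_proj (M : hopfModType B) : M -> bar M := qproj (MBplus_gen M).
Arguments bar_proj M : clear implicits.
HB.instance Definition _ (M : hopfModType B) := GRing.Linear.on (bar_proj M).

Definition bar_map (M N : hopfModType B) (f : hopf_hom M N) : bar M -> bar N :=
  @qlift K M (MBplus_gen M) (bar N) (bar_proj N \o f).

Lemma bar_map_subproof (M N : hopfModType B) (f : hopf_hom M N) x :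
  MBplus_gen M x -> (bar_proj N \o f) x = 0.
Proof.
move=> [m [b [b0 ->]]] /=; rewrite hopf_act -(linear0 (bar_proj N)).
apply/eqP; rewrite qproj_eq subr0; apply: mem_lspan.
by exists (f m), b.
Qed.

Lemma bar_mapE (M N : hopfModType B) (f : hopf_hom M N) m :
  bar_map f (bar_proj _ m) = bar_proj _ (f m).
Proof. exact: (qliftE (@bar_map_subproof M N f)). Qed.

Lemma bar_map_is_linear (M N : hopfModType B) (f : hopf_hom M N) : linear (bar_map f).
Proof. exact: (qlift_is_linear (@bar_map_subproof M N f)). Qed.

HB.instance Definition _ (M N : hopfModType B) (f : hopf_hom M N) :=
  GRing.isLinear.Build K (bar M) (bar N) _ (bar_map f) (bar_map_is_linear f).

Lemma bar_surj (M : hopfModType B) (t : bar M) : exists m, t = bar_proj _ m.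
Proof. exact: qproj_surj. Qed.

Program Definition bar_functor : functor hopf_cat vect_cat :=
  @Functor hopf_cat vect_cat (fun M => bar M) (fun M N f => bar_map f) _ _.
Next Obligation.
by apply: linear_ext => t; have [m ->] := bar_surj t; rewrite /= bar_mapE.
Qed.
Next Obligation.
by apply: linear_ext => t; have [m ->] := bar_surj t; rewrite /= !bar_mapE.
Qed.

Definition sigma_fun (M : hopfModType B) (m : coinv M) : bar M :=
  bar_proj M (coinv_val m).

Lemma sigma_is_linear (M : hopfModType B) : linear (@sigma_fun M).
Proof. by move=> a x y; rewrite /sigma_fun -linearP. Qed.

HB.instance Definition _ (M : hopfModType B) :=
  GRing.isLinear.Build K (coinv M) (bar M) _ (@sigma_fun M) (@sigma_is_linear M).

Program Definition sigma : nat_trans coinv_functor bar_functor :=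
  @NatTrans _ _ coinv_functor bar_functor (fun M => @sigma_fun M) _.
Next Obligation. by apply: linear_ext => m; rewrite /= /sigma_fun bar_mapE. Qed.

Definition right_antipode (S : B -> B) : Prop :=
  forall x : B, tlift (fun x1 x2 : B => x1 * S x2) (comul x) = counit x *: 1.

Definition anti_multiplicative (S : B -> B) : Prop :=
  forall x y : B, S (x * y) = S y * S x.

Definition anti_comultiplicative (S : B -> B) : Prop :=
  forall x : B, comul (S x) = tlift (fun x1 x2 : B => tens (S x2) (S x1)) (comul x).

End HopfModules.

Arguments coinv_pred {K B} M.
Arguments MBplus_gen {K B} M.
Arguments bar_proj {K B} M.

(* Main.v *)
(** Coinvariance is recovered from "integrating" along an antipode: if [S] is
    a right antipode as in (2), then m |-> sum m_0 S(m_1) maps a Hopf module M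
    onto its coinvariants and induces the inverse of sigma.  Given a retraction
    tau of sigma, a linear map g between coinvariants extends to the Hopf module
    morphism m |-> sum g(tau[m_0]) m_1, which yields semiseparability.

    Conversely, let P witness semiseparability and let F(V) = V ⊗ B be the free
    Hopf module.  Applying P to the unit M^coB -> F(M^coB)^coB gives a morphism
    M -> M^coB ⊗ B, hence (through the counit of B) a natural projection t_M of
    M onto M^coB with t_M(mb) = eps(b) t_M(m).  On B ⊗ B with diagonal action
    and coaction on the second leg, t(1 ⊗ b) = S(b) ⊗ 1 defines S; naturality
    then forces t_M(m) = sum m_0 S(m_1) for all M.  Hence
      sum S(b_2)_1 ⊗ b_1 S(b_2)_2 = S(b) ⊗ 1  and
      sum c_1 S(b c_2) = eps(c) S(b),
    and each of the two anti-morphism properties is obtained by evaluating one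
    expression in two ways with these identities. *)

From HB Require Import structures.
Require Import Defs.
From mathcomp Require Import all_boot all_algebra.
From mathcomp Require Import boolp.

Set Implicit Arguments.
Unset Strict Implicit.
Unset Printing Implicit Defensive.

Import GRing.Theory.
Local Open Scope ring_scope.

(** * Linearity of composite expressions *)

Section Lin.
Variable K : fieldType.
Implicit Types U V W M N P Q : lmodType K.

(* [linear] unfolds to a quantified equation; this copy keeps a head symbol for
   the tactic [mlin] to match on. *)
Definition lin U V (f : U -> V) := forall a x y, f (a *: x + y) = a *: f x + f y.

Lemma lin_linear U V (f : U -> V) : lin f -> linear f.
Proof. by []. Qed.

Lemma lin_bilinear M N P (f : M -> N -> P) :
  (forall n, lin (fun m => f m n)) -> (forall m, lin (fun n => f m n)) ->
  bilinear_map f.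
Proof. by []. Qed.

Lemma lin0 U V (f : U -> V) : lin f -> f 0 = 0.
Proof.
by move=> fL; have := fL (-1) 0 0; rewrite !scaleN1r oppr0 addr0 addNr.
Qed.

Lemma linD U V (f : U -> V) x y : lin f -> f (x + y) = f x + f y.
Proof. by move=> fL; rewrite -[x in LHS]scale1r fL scale1r. Qed.

Lemma linZ U V (f : U -> V) a x : lin f -> f (a *: x) = a *: f x.
Proof. by move=> fL; rewrite -[a *: x]addr0 fL (lin0 fL) addr0. Qed.

Lemma lin_id U : lin (fun x : U => x).
Proof. by []. Qed.

Lemma lin_comp U V W (h : {linear V -> W}) (f : U -> V) :
  lin f -> lin (fun x => h (f x)).
Proof. by move=> fL a x y; rewrite fL linearP. Qed.

Lemma lin_fcomp U V W (h : V -> W) (f : U -> V) :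
  lin h -> lin f -> lin (fun x => h (f x)).
Proof. by move=> hL fL a x y; rewrite fL hL. Qed.

Lemma lin_bil1 U (V V' W : lmodType K) (h : {bilinear V -> V' -> W})
    (f : U -> V) b :
  lin f -> lin (fun x => h (f x) b).
Proof. by move=> fL a x y; rewrite fL linearPl. Qed.

Lemma lin_bil2 U (V V' W : lmodType K) (h : {bilinear V -> V' -> W})
    (f : U -> V') b :
  lin f -> lin (fun x => h b (f x)).
Proof. by move=> fL a x y; rewrite fL linearPr. Qed.

Lemma lin_tens1 U M N (f : U -> M) (n : N) :
  lin f -> lin (fun x => tens (f x) n).
Proof. by move=> fL a x y; rewrite fL (tens_bilinear _ _).1. Qed.

Lemma lin_tens2 U M N (f : U -> N) (m : M) :
  lin f -> lin (fun x => tens m (f x)).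
Proof. by move=> fL a x y; rewrite fL (tens_bilinear _ _).2. Qed.

Lemma lin_scale U V (f : U -> V) k : lin f -> lin (fun x => k *: f x).
Proof. by move=> fL a x y; rewrite fL scalerDr !scalerA mulrC. Qed.

Lemma lin_scalar U (U' V : lmodType K) (h : {scalar U'}) (f : U -> U') (v : V) :
  lin f -> lin (fun x => h (f x) *: v).
Proof. by move=> fL a x y; rewrite fL linearP scalerDl scalerA. Qed.

Lemma lin_mul1 U (A : algType K) (f : U -> A) b :
  lin f -> lin (fun x => f x * b).
Proof. by move=> fL a x y; rewrite fL mulrDl scalerAl. Qed.

Lemma lin_mul2 U (A : algType K) (f : U -> A) b :
  lin f -> lin (fun x => b * f x).
Proof. by move=> fL a x y; rewrite fL mulrDr scalerAr. Qed.

Lemma lin_tlift U M N P (f : M -> N -> P) (t : U -> M ⊗ N) :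
  bilinear_map f -> lin t -> lin (fun x => tlift f (t x)).
Proof. by move=> fB tL a x y; rewrite tL tlift_is_linear. Qed.

Lemma lin_tlift_param U M N P (f : U -> M -> N -> P) t :
  (forall x, bilinear_map (f x)) -> (forall m n, lin (fun x => f x m n)) ->
  lin (fun x => tlift (f x) t).
Proof. by move=> fB fL; exact: tlift_param. Qed.

Lemma lin_tmap2l U (M M' P N N' Q : lmodType K) (f : M -> M' -> P)
    (g : N -> N' -> Q) (s : U -> M ⊗ N) t :
  bilinear_map f -> bilinear_map g -> lin s -> lin (fun x => tmap2 f g (s x) t).
Proof. by move=> fB gB sL a x y; rewrite sL (tmap2_bilinear _ _).1. Qed.

Lemma lin_tmap2r U (M M' P N N' Q : lmodType K) (f : M -> M' -> P)
    (g : N -> N' -> Q) (s : M ⊗ N) (t : U -> M' ⊗ N') :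
  bilinear_map f -> bilinear_map g -> lin t -> lin (fun x => tmap2 f g s (t x)).
Proof. by move=> fB gB sL a x y; rewrite sL (tmap2_bilinear _ _).2. Qed.

End Lin.

(* Proves that an expression is (bi)linear in variables that each occur exactly
   once in it, by structural descent; hypotheses [lin h] cover local maps. *)
Ltac mlin := intros; cbv beta;
  lazymatch goal with
  | |- bilinear_for _ _ _ => apply: lin_bilinear => ?; mlin
  | |- forall _, _ => intro; mlin
  | |- lin (fun x => x) => exact: lin_id
  | |- lin (fun x => tens _ _) =>
      first [apply: lin_tens1; mlin | apply: lin_tens2; mlin]
  | |- lin (fun x => tlift _ _) =>
      first [apply: lin_tlift; mlin | apply: lin_tlift_param; mlin]
  | |- lin (fun x => tmap2 _ _ _ _) =>
      first [apply: lin_tmap2l; mlin | apply: lin_tmap2r; mlin]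
  | |- lin (fun x => GRing.mul _ _) =>
      first [apply: lin_mul1; mlin | apply: lin_mul2; mlin]
  | |- lin (fun x => GRing.scale _ _) =>
      first [apply: lin_scale; mlin | apply: lin_scalar; mlin]
  | |- lin (fun x => Bilinear.sort _ _ _) =>
      first [apply: lin_bil1; mlin | apply: lin_bil2; mlin]
  | |- lin (fun x => _ _) =>
      match goal with
      | H : lin ?h |- lin (fun x => ?h _) => apply: (lin_fcomp H); mlin
      | |- _ => apply: lin_comp; mlin
      | |- _ => apply: lin_bil1; mlin
      | |- _ => apply: lin_bil2; mlin
      end
  | |- lin _ => match goal with |- lin ?f => change (lin (fun x => f x)); mlin end
  end.

(** * Calculus of Sweedler sums *)

Section Sweedler.
Variable K : fieldType.
Implicit Types L M N P Q : lmodType K.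

(** Phrased with [lin] hypotheses on bare functions, so that expressions built from [tlift] need no
    bundled linear structure and [mlin] settles the side conditions. *)
Lemma tens_ext M N P (f g : M ⊗ N -> P) : lin f -> lin g ->
  (forall m n, f (tens m n) = g (tens m n)) -> forall t, f t = g t.
Proof.
move=> fL gL fg; elim/tens_ind => [|m n t IH].
  by rewrite !lin0.
by rewrite !linD // fg IH.
Qed.

Lemma eq_tlift M N P (f g : M -> N -> P) t :
  (forall m n, f m n = g m n) -> tlift f t = tlift g t.
Proof. by move=> fg; congr (tlift _ t); apply/funext => m; apply/funext. Qed.

Lemma tlift_tens M N (t : M ⊗ N) : tlift (fun m n => tens m n) t = t.
Proof. by move: t; apply: tens_ext; [mlin|mlin|] => m n; rewrite tliftE; [|mlin]. Qed.

(** Both sides are linear in [t] and agree on pure tensors. This is the basic rule for moving a map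
    under a Sweedler sum. *)
Lemma lin_tliftE M N P Q (g : P -> Q) (f : M -> N -> P) t :
  lin g -> bilinear_map f -> g (tlift f t) = tlift (fun m n => g (f m n)) t.
Proof.
move=> gL fB.
have gfB : bilinear_map (fun m n => g (f m n)).
  by split=> [n|m] a x y; rewrite -gL; congr g; [exact: fB.1 | exact: fB.2].
move: t; apply: tens_ext => [||m n]; last by rewrite !tliftE.
- by move=> a x y; rewrite -gL; congr g; exact: tlift_is_linear.
- exact: tlift_is_linear.
Qed.

(** Fubini for two independent Sweedler sums: by linearity in [s] only a pure tensor has to be
    checked, and there the inner sum on the right collapses. *)
Lemma exchange_tlift L M N N' P (f : L -> M -> N -> N' -> P) s t :
  (forall n n', bilinear_map (fun l m => f l m n n')) ->
  (forall l m, bilinear_map (f l m)) ->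
  tlift (fun l m => tlift (f l m) t) s =
  tlift (fun n n' => tlift (fun l m => f l m n n') s) t.
Proof.
move=> f1 f2.
have B1 t' : bilinear_map (fun l m => tlift (f l m) t').
  by split=> [m|l]; apply: tlift_param => // n n';
    [exact: (f1 n n').1 | exact: (f1 n n').2].
move: s; apply: tens_ext => [||l m].
- exact: tlift_is_linear (B1 t).
- apply: lin_tlift_param => [s|n n']; last exact: tlift_is_linear (f1 n n').
  by split=> [n'|n]; apply: tlift_param => // l m;
    [exact: (f2 l m).1 | exact: (f2 l m).2].
- rewrite (tliftE (B1 t)); apply: eq_tlift => n n'; exact/esym/(tliftE (f1 n n')).
Qed.

(* Coassociativity in Sweedler form, for [d] a coaction or a comultiplication. *)
Lemma tlift_tassoc L L' M N N' P (d : {linear L -> M ⊗ N})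
    (e : {linear L' -> N ⊗ N'}) s t (f : M -> N -> N' -> P) :
  (forall n', bilinear_map (fun m n => f m n n')) ->
  (forall m n, lin (f m n)) ->
  tassoc (tmap d idfun s) = tmap idfun e t ->
  tlift (fun l n' => tlift (fun m n => f m n n') (d l)) s =
  tlift (fun m l' => tlift (fun n n' => f m n n') (e l')) t.
Proof.
move=> f12 f3 ste.
have f1 n n' : lin (fun m => f m n n') by move=> a x y; exact: (f12 n').1.
have f2 m n' : lin (fun n => f m n n') by move=> a x y; exact: (f12 n').2.
have f23 m : bilinear_map (f m).
  by split=> [n'|n]; [exact: f2 | exact: f3].
(* [g] is the linear map on M ⊗ (N ⊗ N') induced by [f]; the claim is its value on both sides of the
   coassociativity equation. *)
pose g t' := tlift (fun m t => tlift (f m) t) t'.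
have gB : bilinear_map (fun m t => tlift (f m) t).
  split=> [u|m]; first exact: tlift_param.
  exact: tlift_is_linear.
have gL : lin g by exact: tlift_is_linear.
transitivity (g (tassoc (tmap d idfun s))).
  rewrite /tmap /tassoc lin_tliftE //; last by mlin.
  rewrite (lin_tliftE (g := tlift _)); [|mlin|mlin].
  apply: eq_tlift => l n' /=; rewrite tliftE; last by mlin.
  by rewrite lin_tliftE //; [apply: eq_tlift => m n; rewrite /g !tliftE | mlin].
rewrite ste /tmap lin_tliftE //; last by mlin.
by apply: eq_tlift => m l'; rewrite /g tliftE.
Qed.

End Sweedler.

Section Bialg.
Variables (K : fieldType) (B : bialgType K).
Implicit Types (P : lmodType K) (x : B).

Lemma comul_assoc P (f : B -> B -> B -> P) x :
  (forall n', bilinear_map (fun m n => f m n n')) ->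
  (forall m n, lin (f m n)) ->
  tlift (fun x1 x2 => tlift (fun x11 x12 => f x11 x12 x2) (comul x1)) (comul x) =
  tlift (fun x1 x2 => tlift (fun x21 x22 => f x1 x21 x22) (comul x2)) (comul x).
Proof. by move=> f1 f2; apply: tlift_tassoc => //; exact: comulA. Qed.

(** The counit law under a linear [f]. Read from right to left it inserts a counit, after which two
    sums can be compared summand by summand. *)
Lemma comul_unitl P (f : B -> P) x : lin f ->
  tlift (fun x1 x2 => counit x1 *: f x2) (comul x) = f x.
Proof.
move=> fL; rewrite -{2}(comul_counitl x) lin_tliftE //; last by mlin.
by apply: eq_tlift => m n; rewrite linZ.
Qed.

Lemma comul_unitr P (f : B -> P) x : lin f ->
  tlift (fun x1 x2 => counit x2 *: f x1) (comul x) = f x.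
Proof.
move=> fL; rewrite -{2}(comul_counitr x) lin_tliftE //; last by mlin.
by apply: eq_tlift => m n; rewrite linZ.
Qed.

Variable M : hopfModType B.

Lemma coact_assoc P (f : M -> B -> B -> P) m :
  (forall n', bilinear_map (fun m n => f m n n')) ->
  (forall m n, lin (f m n)) ->
  tlift (fun m0 m1 => tlift (fun m00 m01 => f m00 m01 m1) (coact m0)) (coact m) =
  tlift (fun m0 m1 => tlift (fun m11 m12 => f m0 m11 m12) (comul m1)) (coact m).
Proof. by move=> f1 f2; apply: tlift_tassoc => //; exact: coactA. Qed.

Lemma coact_unit P (f : M -> P) m : lin f ->
  tlift (fun m0 m1 => counit m1 *: f m0) (coact m) = f m.
Proof.
move=> fL; rewrite -{2}(coact_counit m) lin_tliftE //; last by mlin.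
by apply: eq_tlift => m0 n; rewrite linZ.
Qed.

End Bialg.

(** * The Hopf module V ⊗ B of a right B-module V *)

Section Hat.
Variables (K : fieldType) (B : bialgType K).

(** A plain record rather than a canonical structure, because one space may carry several actions,
    such as the trivial and the regular one on B. *)
Record rmodule := RModule {
  rm_sort :> lmodType K;
  rm_act : {bilinear rm_sort -> B -> rm_sort};
  rm_act1 : forall v, rm_act v 1 = v;
  rm_actM : forall v b c, rm_act v (b * c) = rm_act (rm_act v b) c
}.

Variable V : rmodule.

(* Diagonal action, coaction on the second factor. *)
Definition hat := V ⊗ B.
HB.instance Definition _ := GRing.Lmodule.on hat.

Definition hat_act (t : hat) (c : B) : hat := tmap2 (rm_act V) *%R t (comul c).

Lemma hat_act_bilinear : bilinear_map hat_act.
Proof. by rewrite /hat_act; mlin. Qed.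

HB.instance Definition _ :=
  bilinear_isBilinear.Build K hat B hat *:%R *:%R hat_act hat_act_bilinear.

Definition hat_coact (t : hat) : hat ⊗ B :=
  tlift (fun v b => tlift (fun b1 b2 => tens (tens v b1 : hat) b2) (comul b)) t.

Lemma hat_coact_linear : linear hat_coact.
Proof. by apply: lin_linear; rewrite /hat_coact; mlin. Qed.

HB.instance Definition _ :=
  GRing.isLinear.Build K hat (hat ⊗ B) _ hat_coact hat_coact_linear.

Lemma hat_actE v b c : hat_act (tens v b) c =
  tlift (fun c1 c2 => tens (rm_act V v c1) (b * c2)) (comul c).
Proof.
rewrite /hat_act; move: (comul c); apply: tens_ext => [||c1 c2]; [mlin|mlin|].
by rewrite tmap2E ?tliftE //; mlin.
Qed.

Lemma hat_coactE v b : hat_coact (tens v b) =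
  tlift (fun b1 b2 => tens (tens v b1 : hat) b2) (comul b).
Proof. by rewrite /hat_coact tliftE //; mlin. Qed.

Lemma hat_act1 t : hat_act t 1 = t.
Proof.
rewrite /hat_act comul1; move: t; apply: tens_ext => [||v b]; [mlin|mlin|].
by rewrite tmap2E ?rm_act1 ?mulr1 //; mlin.
Qed.

Lemma hat_actM t b c : hat_act t (b * c) = hat_act (hat_act t b) c.
Proof.
rewrite /hat_act comulM; move: (comul b) (comul c) => b' c'.
move: t; apply: tens_ext => [||v x]; [mlin|mlin|].
move: b'; apply: tens_ext => [||b1 b2]; [mlin|mlin|].
move: c'; apply: tens_ext => [||c1 c2]; [mlin|mlin|].
by rewrite !tmap2E ?rm_actM ?mulrA //; mlin.
Qed.

Lemma hat_coactA t :
  tassoc (tmap hat_coact idfun (hat_coact t)) = tmap idfun comul (hat_coact t).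
Proof.
rewrite /tassoc /tmap; move: t; apply: tens_ext => [||v b]; [mlin|mlin|].
rewrite hat_coactE !lin_tliftE; try mlin.
transitivity (tlift (fun b1 b2 => tlift (fun b11 b12 =>
    tens (tens v b11 : hat) (tens b12 b2)) (comul b1)) (comul b)).
  apply: eq_tlift => b1 b2; rewrite tliftE; [|mlin].
  rewrite tliftE; [|mlin].
  rewrite hat_coactE lin_tliftE; [|mlin|mlin].
  by apply: eq_tlift => c d; rewrite tliftE //; mlin.
rewrite comul_assoc; [|mlin|mlin].
apply: eq_tlift => b1 b2; rewrite tliftE; [|mlin].
by rewrite -[comul b2 in RHS]tlift_tens lin_tliftE //; mlin.
Qed.

Lemma hat_coact_counit t :
  tlift (fun (m0 : hat) (m1 : B) => counit m1 *: m0) (hat_coact t) = t.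
Proof.
move: t; apply: tens_ext => [||v b]; [mlin|mlin|].
rewrite hat_coactE lin_tliftE; [|mlin|mlin].
rewrite -[RHS](comul_unitr (f := fun b => tens v b)); last by mlin.
by apply: eq_tlift => b1 b2; rewrite tliftE //; mlin.
Qed.

(** For t = v ⊗ b both sides are sum v c_1 ⊗ b_1 c_2 ⊗ b_2 c_3. Multiplicativity of Delta produces
    this with the second leg of Delta(c) split, the right side has the first leg split, and
    coassociativity joins them. *)
Lemma hat_coact_act t c :
  hat_coact (hat_act t c) = tmap2 hat_act *%R (hat_coact t) (comul c).
Proof.
move: t; apply: tens_ext => [||v b]; [mlin|mlin|].
rewrite hat_actE hat_coactE lin_tliftE; [|mlin|mlin].
transitivity (tlift (fun b1 b2 => tlift (fun c1 c2 => tlift (fun c11 c12 =>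
    tens (tens (rm_act V v c11) (b1 * c12) : hat) (b2 * c2))
      (comul c1)) (comul c)) (comul b)).
  transitivity (tlift (fun b1 b2 => tlift (fun c1 c2 => tlift (fun c21 c22 =>
    tens (tens (rm_act V v c1) (b1 * c21) : hat) (b2 * c22))
      (comul c2)) (comul c)) (comul b)); last first.
    by apply: eq_tlift => b1 b2; rewrite -comul_assoc //; mlin.
  rewrite exchange_tlift; [|mlin|mlin].
  apply: eq_tlift => c1 c2; rewrite hat_coactE comulM.
  rewrite /tmap2 lin_tliftE; [|mlin|mlin].
  apply: eq_tlift => b1 b2; rewrite lin_tliftE; [|mlin|mlin].
  by apply: eq_tlift => c3 c4; rewrite tliftE; [|mlin].
rewrite [RHS]/tmap2 lin_tliftE; [|mlin|mlin].
apply: eq_tlift => b1 b2.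
rewrite tliftE; [|mlin].
apply: eq_tlift => c1 c2; rewrite hat_actE.
by rewrite (lin_tliftE (g := fun t => tens t (b2 * c2))) //; mlin.
Qed.

HB.instance Definition _ := isHopfModule.Build K B hat
  hat_act1 hat_actM hat_coactA hat_coact_counit hat_coact_act.
End Hat.

(** * Antipodes *)

Section Antipode.
Variables (K : fieldType) (B : bialgType K) (S : {linear B -> B}).

(** Apply eps to sum x_1 S(x_2) = eps(x) 1: the left side becomes sum eps(x_1) eps(S(x_2)) =
    eps(S(x)). *)
Lemma counit_right_antipode :
  right_antipode S -> forall x, counit (S x) = counit x.
Proof.
(* Scalars are written as multiples of 1 in B, because Sweedler sums take values in a vector
   space. *)
move=> SP x; suff /(congr1 counit) : counit (S x) *: (1 : B) = counit x *: 1.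
  by rewrite !linearZ /= counit1 !mulr1.
rewrite -[LHS](comul_unitl (f := fun x => counit (S x) *: (1 : B))); last by mlin.
have := congr1 (fun y => counit y *: (1 : B)) (SP x).
rewrite (lin_tliftE (g := fun y => counit y *: (1 : B))); [|mlin|mlin].
rewrite linearZ /= counit1 mulr1 => <-.
by apply: eq_tlift => x1 x2; rewrite counitM scalerA.
Qed.

Lemma right_antipode1 : right_antipode S -> S 1 = 1.
Proof.
move=> /(_ 1); rewrite comul1 tliftE; last by mlin.
by rewrite mul1r counit1 scale1r.
Qed.

Hypothesis S_coinv : forall b,
  tlift (fun b1 b2 => tlift (fun c1 c2 => tens c1 (b1 * c2)) (comul (S b2)))
    (comul b) = tens (S b) (1 : B).
Hypothesis S_act : forall b c,
  tlift (fun c1 c2 => c1 * S (b * c2)) (comul c) = counit c *: S b.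
Hypothesis S1 : S 1 = 1.

(** This is the case b = 1 of [S_act]. *)
Lemma right_antipode_of_act : right_antipode S.
Proof.
move=> x; rewrite -S1 -S_act.
by apply: eq_tlift => x1 x2; rewrite mul1r.
Qed.

Lemma anti_multiplicative_of_coinv : anti_multiplicative S.
Proof.
(* sum S(b_2)_1 S(x b_1 S(b_2)_2) is S(b) S(x) by S_coinv, S(x b) by S_act *)
move=> x b; pose phi t := tlift (fun p q : B => p * S (x * q)) t.
have phiE p q : phi (tens p q) = p * S (x * q) by rewrite /phi tliftE //; mlin.
have phiL : lin phi by rewrite /phi; mlin.
have -> : S b * S x = phi (tens (S b) 1) by rewrite phiE mulr1.
rewrite -S_coinv lin_tliftE; [|mlin|mlin].
rewrite -[LHS](comul_unitr (f := fun b => S (x * b))); last by mlin.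
apply: eq_tlift => b1 b2; rewrite lin_tliftE; [|mlin|mlin].
(* Replacing eps(b_2) by eps(S(b_2)) makes [S_act] applicable with S(b_2) as the acting element and
   x b_1 as the other argument. *)
rewrite -(counit_right_antipode right_antipode_of_act) -S_act.
by apply: eq_tlift => c1 c2; rewrite phiE mulrA.
Qed.

Lemma anti_comultiplicative_of_coinv : anti_comultiplicative S.
Proof.
(* sum S(z_2)_1 ⊗ S(z_2)_2 S(z_1 S(z_2)_3) is Delta(S(z)) by S_coinv, and
   sum S(z_2) ⊗ S(z_1) by S_act *)
move=> z; pose psi t := tlift (fun p q : B =>
  tlift (fun p1 p2 : B => tens p1 (p2 * S q)) (comul p)) t.
have psiE p q : psi (tens p q) = tlift (fun p1 p2 => tens p1 (p2 * S q)) (comul p).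
  by rewrite /psi tliftE //; mlin.
have psiL : lin psi by rewrite /psi; mlin.
have -> : comul (S z) = psi (tens (S z) 1).
  rewrite psiE S1 -[LHS]tlift_tens; by apply: eq_tlift => p1 p2; rewrite mulr1.
rewrite -S_coinv lin_tliftE; [|mlin|mlin].
apply: eq_tlift => z1 z2; rewrite lin_tliftE; [|mlin|mlin].
rewrite -[RHS](comul_unitr (f := fun c => tens c (S z1))); last by mlin.
(* With c = S(z_2), coassociativity moves the splitting to the second leg, where [S_act] contracts
   c_2 S(z_1 c_3) to eps(c_2) S(z_1). *)
transitivity (tlift (fun c1 c2 =>
    tlift (fun c21 c22 => tens c1 (c21 * S (z1 * c22))) (comul c2)) (comul (S z2))).
  by rewrite -comul_assoc; [|mlin|mlin]; apply: eq_tlift => c1 c2; rewrite psiE.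
apply: eq_tlift => c1 c2.
rewrite -(lin_tliftE (g := fun t => tens c1 t)); [|mlin|mlin].
by rewrite S_act (linZ (f := fun t => tens c1 t)); last by mlin.
Qed.

End Antipode.

(** * The quotient by M B^+ *)

Section BarProj.
Variables (K : fieldType) (B : bialgType K) (M : hopfModType B).

(** The difference mb - eps(b) m equals m (b - eps(b) 1), and b - eps(b) 1 lies in B^+. *)
Lemma bar_proj_act (m : M) (b : B) :
  bar_proj M (ract m b) = counit b *: bar_proj M m.
Proof.
rewrite -linearZ /=; apply/eqP; rewrite qproj_eq; apply: mem_lspan.
exists m, (b - counit b *: 1); split.
  by rewrite linearB linearZ /= counit1 mulr1 subrr.
by rewrite linearBr linearZr_LR ract1.
Qed.

End BarProj.

(** * From the antipode to semiseparability *)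

Section SigmaInverse.
Variables (K : fieldType) (B : bialgType K) (S : {linear B -> B}).
Hypotheses (SP : right_antipode S) (SM : anti_multiplicative S).
Hypothesis (SC : anti_comultiplicative S).

Section Component.
Variable M : hopfModType B.

Definition antipode_proj (m : M) : M :=
  tlift (fun m0 m1 => ract m0 (S m1)) (coact m).

Lemma lin_antipode_proj : lin antipode_proj.
Proof. by rewrite /antipode_proj; mlin. Qed.

(** Anti-comultiplicativity turns the coaction of sum m_0 S(m_1) into sum m_0 S(m_3) ⊗ m_1 S(m_2),
    and the right antipode law collapses m_1 S(m_2). *)
Lemma antipode_proj_coinv m : antipode_proj m \in coinv_pred M.
Proof.
apply/eqP; rewrite lin_tliftE; [|mlin|mlin].
transitivity (tlift (fun m0 m1 => tlift (fun m00 m01 =>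
    tlift (fun m11 m12 => tens (ract m00 (S m12)) (m01 * S m11)) (comul m1))
    (coact m0)) (coact m)).
  apply: eq_tlift => m0 m1; rewrite coact_act SC /tmap2.
  apply: eq_tlift => m00 m01.
  rewrite (lin_tliftE (g := tlift _)); [|mlin|mlin].
  by apply: eq_tlift => m11 m12; rewrite tliftE //; mlin.
rewrite coact_assoc; [|mlin|mlin].
rewrite /antipode_proj (lin_tliftE (g := fun t => tens t (1 : B))); [|mlin|mlin].
apply: eq_tlift => m0 m1.
rewrite -(comul_assoc (f := fun p q r => tens (ract m0 (S r)) (p * S q)));
  [|mlin|mlin].
rewrite -[RHS](comul_unitl (f := fun r => tens (ract m0 (S r)) (1 : B)));
  last by mlin.
apply: eq_tlift => x1 x2.
rewrite -(lin_tliftE (g := fun t => tens (ract m0 (S x2)) t)); [|mlin|mlin].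
by rewrite SP (linZ (f := fun t => tens (ract m0 (S x2)) t)); last by mlin.
Qed.

(** By anti-multiplicativity sum m_0 b_1 S(m_1 b_2) = sum m_0 b_1 S(b_2) S(m_1), where b_1 S(b_2)
    collapses to eps(b). *)
Lemma antipode_proj_act m b :
  antipode_proj (ract m b) = counit b *: antipode_proj m.
Proof.
rewrite /antipode_proj coact_act /tmap2 lin_tliftE; [|mlin|mlin].
rewrite [RHS](lin_tliftE (g := fun t => counit b *: t)); [|mlin|mlin].
apply: eq_tlift => m0 m1.
rewrite lin_tliftE; [|mlin|mlin].
transitivity (tlift (fun b1 b2 => ract m0 (b1 * S b2 * S m1)) (comul b)).
  by apply: eq_tlift => b1 b2; rewrite tliftE ?SM -?ractM ?mulrA //; mlin.
rewrite -(lin_tliftE (g := fun t => ract m0 (t * S m1))); [|mlin|mlin].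
by rewrite SP -scalerAl mul1r linearZ.
Qed.

Lemma antipode_proj_id m : m \in coinv_pred M -> antipode_proj m = m.
Proof.
move=> /eqP mC; rewrite /antipode_proj mC tliftE; last by mlin.
by rewrite (right_antipode1 SP) ract1.
Qed.

Definition antipode_coinv (m : M) : coinv M := Coinv (antipode_proj_coinv m).

Lemma antipode_coinv_linear : linear antipode_coinv.
Proof. by move=> a x y; apply/val_inj/lin_antipode_proj. Qed.

HB.instance Definition _ :=
  GRing.isLinear.Build K M (coinv M) _ antipode_coinv antipode_coinv_linear.

Lemma antipode_coinv_MBplus x : MBplus_gen M x -> antipode_coinv x = 0.
Proof.
by case=> m [b [b0 ->]]; apply/val_inj; rewrite /= antipode_proj_act b0 scale0r.
Qed.

Definition sigma_inv_fun : bar M -> coinv M := qlift antipode_coinv.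

Lemma sigma_inv_funE m : sigma_inv_fun (bar_proj M m) = antipode_coinv m.
Proof. exact: qliftE antipode_coinv_MBplus m. Qed.

Lemma sigma_inv_fun_linear : linear sigma_inv_fun.
Proof. exact: qlift_is_linear antipode_coinv_MBplus. Qed.

HB.instance Definition _ :=
  GRing.isLinear.Build K (bar M) (coinv M) _ sigma_inv_fun sigma_inv_fun_linear.

(** Modulo M B^+ the element S(m_1) acts by eps(S(m_1)) = eps(m_1), so the counit law of the
    coaction applies. *)
Lemma bar_proj_antipode m : bar_proj M (antipode_proj m) = bar_proj M m.
Proof.
rewrite lin_tliftE; [|mlin|mlin].
rewrite -[RHS](coact_unit (f := bar_proj M)); last by mlin.
by apply: eq_tlift => m0 m1; rewrite bar_proj_act counit_right_antipode.
Qed.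

End Component.

Lemma sigma_inv_natural (M N : hopfModType B) (f : hopf_hom M N) :
  @sigma_inv_fun N \o bar_map f = coinv_map f \o @sigma_inv_fun M
    :> {linear bar M -> coinv N}.
Proof.
apply: linear_ext => t; have [m ->] := bar_surj t.
rewrite /= bar_mapE !sigma_inv_funE; apply/val_inj => /=.
rewrite /antipode_proj hopf_coact /tmap.
rewrite !lin_tliftE; try mlin.
by apply: eq_tlift => m0 m1; rewrite tliftE ?hopf_act //; mlin.
Qed.

Definition sigma_inv : nat_trans (bar_functor B) (coinv_functor B) :=
  @NatTrans _ _ (bar_functor B) (coinv_functor B) (fun M => @sigma_inv_fun M)
    sigma_inv_natural.

Lemma sigma_invertible : nt_invertible (sigma B).
Proof.
exists sigma_inv; split; apply: nat_trans_ext => M; apply: linear_ext => x.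
  rewrite /= /sigma_fun /= sigma_inv_funE; apply/val_inj => /=.
  exact/antipode_proj_id/(valP x).
have [m ->] := bar_surj x.
by rewrite /= sigma_inv_funE /sigma_fun /= bar_proj_antipode.
Qed.

End SigmaInverse.

(** * Semiseparability from a retraction of sigma *)

Section SemiseparableOfSplit.
Variables (K : fieldType) (B : bialgType K).
Variable tau : nat_trans (bar_functor B) (coinv_functor B).

Section Component.
Variables (M N : hopfModType B) (g : {linear coinv M -> coinv N}).

Definition coinv_retract (m : M) : N := val (g (tau M (bar_proj M m))).

Lemma lin_coinv_retract : lin coinv_retract.
Proof. by move=> a x y; rewrite /coinv_retract !linearP. Qed.

Definition coinv_ext (m : M) : N :=
  tlift (fun m0 m1 => ract (coinv_retract m0) m1) (coact m).

Lemma coinv_ext_linear : linear coinv_ext.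
Proof.
apply: lin_linear; have := lin_coinv_retract => rL.
by rewrite /coinv_ext; mlin.
Qed.

HB.instance Definition _ :=
  GRing.isLinear.Build K M N _ coinv_ext coinv_ext_linear.

(** Write r for [coinv_retract]. It factors through M / M B^+, so r(m_0 b_1) = eps(b_1) r(m_0) and
    sum r(m_0 b_1) m_1 b_2 = sum r(m_0) m_1 b. *)
Lemma coinv_ext_act m b : coinv_ext (ract m b) = ract (coinv_ext m) b.
Proof.
have rL := lin_coinv_retract.
rewrite /coinv_ext coact_act /tmap2 lin_tliftE; [|mlin|mlin].
rewrite (lin_tliftE (g := fun x => ract x b)); [|mlin|mlin].
apply: eq_tlift => m0 m1; rewrite lin_tliftE; [|mlin|mlin].
rewrite -ractM.
rewrite -[RHS](comul_unitl (f := fun b => ract (coinv_retract m0) (m1 * b)));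
  last by mlin.
apply: eq_tlift => b1 b2; rewrite tliftE; last by mlin.
by rewrite /coinv_retract bar_proj_act !linearZ /= linearZl_LR.
Qed.

(** Since [coinv_retract] has coinvariant values, the coaction only splits m_1; coassociativity
    moves that splitting to m_0. *)
Lemma coact_coinv_ext m : coact (coinv_ext m) = tmap coinv_ext idfun (coact m).
Proof.
have rL := lin_coinv_retract.
rewrite /tmap {1}/coinv_ext lin_tliftE; [|mlin|mlin].
transitivity (tlift (fun m0 m1 => tlift (fun b1 b2 =>
    tens (ract (coinv_retract m0) b1) b2) (comul m1)) (coact m)).
  apply: eq_tlift => m0 m1; rewrite coact_act coinvP /tmap2.
  rewrite tliftE; last by mlin.
  by apply: eq_tlift => b1 b2; rewrite mul1r.
rewrite -coact_assoc; [|mlin|mlin].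
apply: eq_tlift => m0 m1 /=.
by rewrite (lin_tliftE (g := fun t => tens t m1)) //; mlin.
Qed.

Definition coinv_ext_hom : hopf_hom M N := HopfHom coinv_ext_act coact_coinv_ext.

End Component.

Lemma coinv_ext_natural (X Y : prod_cat (op_cat (hopf_cat B)) (hopf_cat B))
    (f : Defs.hom X Y) :
  cat_comp (c := type_cat) (@coinv_ext_hom Y.1 Y.2)
    (fmap (hom_functor_along (coinv_functor B)) f) =
  cat_comp (c := type_cat) (fmap (hom_functor (hopf_cat B)) f)
    (@coinv_ext_hom X.1 X.2).
Proof.
case: X Y f => [X1 X2] [Y1 Y2] [/= f1 f2].
apply/funext => g; apply: hopf_hom_ext => m /=.
rewrite /coinv_ext hopf_coact /tmap.
have gL := lin_coinv_retract g.
have g'L := lin_coinv_retract (coinv_map f2 \o (g \o coinv_map f1)).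
rewrite lin_tliftE; [|mlin|mlin].
rewrite [RHS]lin_tliftE; [|mlin|mlin].
apply: eq_tlift => m0 m1; rewrite tliftE; [|mlin].
rewrite hopf_act /coinv_retract /=; congr (ract (f2 (val (g _))) m1).
have := congr1 (fun h : {linear _ -> _} => h (bar_proj _ m0)) (nt_natural tau f1).
by rewrite /= bar_mapE => ->.
Qed.

Definition coinv_ext_nt :
    nat_trans (hom_functor_along (coinv_functor B)) (hom_functor (hopf_cat B)) :=
  @NatTrans _ _ (hom_functor_along (coinv_functor B)) (hom_functor (hopf_cat B))
    (fun X => @coinv_ext_hom X.1 X.2) coinv_ext_natural.

(** On a coinvariant m the coaction is m ⊗ 1, so the extension of f has value f(tau[m]), which is
    f(m) because tau retracts sigma. *)
Lemma semiseparable_of_split :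
  nt_comp tau (sigma B) = nt_id (coinv_functor B) ->
  semiseparable (coinv_functor B).
Proof.
move=> ts; exists coinv_ext_nt; apply: nat_trans_ext => X.
case: X => X1 X2; apply/funext => /= f.
apply: linear_ext => m; apply/val_inj => /=.
rewrite /coinv_ext coinvP tliftE; last first.
  by have := lin_coinv_retract (coinv_map f) => fL; mlin.
rewrite ract1 /coinv_retract.
have := congr1 (fun s : nat_trans (coinv_functor B) (coinv_functor B) =>
  s (X1 : hopf_cat B)) ts.
by move=> /(congr1 (fun h : {linear coinv X1 -> coinv X1} => h m)) /= ->.
Qed.

End SemiseparableOfSplit.

(** * From semiseparability to the antipode *)

Section HatMaps.
Variables (K : fieldType) (B : bialgType K).

(** The map id ⊗ eps, a left inverse of v |-> v ⊗ 1. *)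
Definition hat_eps (V : rmodule B) (t : hat V) : V :=
  tlift (fun v b => counit b *: v) t.

Lemma hat_epsE (V : rmodule B) (v : V) b :
  hat_eps (tens v b : hat V) = counit b *: v.
Proof. by rewrite /hat_eps tliftE //; mlin. Qed.

Lemma lin_hat_eps (V : rmodule B) : lin (@hat_eps V).
Proof. by rewrite /hat_eps; mlin. Qed.

Lemma tens1_inj (V : rmodule B) (v w : V) : tens v (1 : B) = tens w 1 -> v = w.
Proof.
by move=> /(congr1 (@hat_eps V)); rewrite !hat_epsE counit1 !scale1r.
Qed.

(** Apply (id ⊗ eps) ⊗ id to the hypothesis: the counit law returns t on the left, and the right
    side becomes (id ⊗ eps)(t) ⊗ 1. *)
Lemma hat_coinv (V : rmodule B) (t : hat V) :
  coact t = tens t 1 -> t = tens (hat_eps t) 1.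
Proof.
have eL := @lin_hat_eps V.
pose th u := tlift (fun (s : hat V) (c : B) => tens (hat_eps s) c) u.
move=> /(congr1 th); rewrite /th tliftE; last by mlin.
move=> <-; rewrite -/(th _).
have thL : lin th by rewrite /th; mlin.
move: t; apply: tens_ext => [||v b]; [mlin|mlin|].
rewrite [coact _]hat_coactE lin_tliftE; [|mlin|mlin].
rewrite -[LHS](comul_unitl (f := fun b => tens v b)); last by mlin.
apply: eq_tlift => b1 b2; rewrite /th tliftE; last by mlin.
by rewrite hat_epsE (linZ (f := fun u => tens u b2)) //; mlin.
Qed.

Section HatMap.
Variables (V W : rmodule B) (f : {linear V -> W}).
Hypothesis f_act : forall v b, f (rm_act V v b) = rm_act W (f v) b.

Definition hat_map (t : hat V) : hat W := tmap f idfun t.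

Lemma hat_map_linear : linear hat_map.
Proof. exact: tmap_is_linear (linearP f) (linearP idfun). Qed.

HB.instance Definition _ :=
  GRing.isLinear.Build K (hat V) (hat W) _ hat_map hat_map_linear.

Lemma hat_mapE v b : hat_map (tens v b) = tens (f v) b.
Proof. exact: tmapE (linearP f) (linearP idfun) _ _. Qed.

Lemma hat_map_act t b : hat_map (ract t b) = ract (hat_map t) b.
Proof.
move: t; apply: tens_ext => [||v c]; [mlin|mlin|].
rewrite hat_mapE [ract _ _ in LHS]hat_actE [RHS]hat_actE lin_tliftE; [|mlin|mlin].
by apply: eq_tlift => b1 b2; rewrite hat_mapE f_act.
Qed.

Lemma hat_map_coact t : coact (hat_map t) = tmap hat_map idfun (coact t).
Proof.
rewrite /tmap; move: t; apply: tens_ext => [||v c]; [mlin|mlin|].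
rewrite hat_mapE [coact _ in RHS]hat_coactE [LHS]hat_coactE lin_tliftE; [|mlin|mlin].
by apply: eq_tlift => b1 b2; rewrite tliftE ?hat_mapE //; mlin.
Qed.

Definition hat_hom : hopf_hom (hat V) (hat W) := HopfHom hat_map_act hat_map_coact.

End HatMap.

End HatMaps.

(** * Trivial and regular modules, and the coaction as a morphism *)

Section RModules.
Variables (K : fieldType) (B : bialgType K).

Section Mod.
Variable V : lmodType K.
Definition triv_act (v : V) (b : B) : V := counit b *: v.

Lemma triv_act_bilinear : bilinear_map triv_act.
Proof. by rewrite /triv_act; mlin. Qed.

HB.instance Definition _ :=
  bilinear_isBilinear.Build K V B V *:%R *:%R triv_act triv_act_bilinear.

Lemma triv_act1 v : triv_act v 1 = v.
Proof. by rewrite /triv_act counit1 scale1r. Qed.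

Lemma triv_actM v b c : triv_act v (b * c) = triv_act (triv_act v b) c.
Proof. by rewrite /triv_act counitM scalerA mulrC. Qed.

Definition triv_rm : rmodule B := RModule triv_act1 triv_actM.
End Mod.

Definition reg_act (x y : B) := x * y.
Lemma reg_act_bilinear : bilinear_map reg_act.
Proof. by rewrite /reg_act; mlin. Qed.

HB.instance Definition _ :=
  bilinear_isBilinear.Build K B B B *:%R *:%R reg_act reg_act_bilinear.

Definition reg_rm : rmodule B := @RModule K B B reg_act (@mulr1 B) (@mulrA B).

Definition hopf_rm (M : hopfModType B) : rmodule B :=
  @RModule K B M ract (@ract1 K B M) (@ractM K B M).

Lemma coact_hat_act (M : hopfModType B) (m : M) b :
  (coact (ract m b) : hat (hopf_rm M)) = ract (coact m : hat (hopf_rm M)) b.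
Proof. exact: coact_act. Qed.

Lemma coact_hat_coact (M : hopfModType B) (m : M) :
  coact (coact m : hat (hopf_rm M)) =
    tmap (coact : M -> hat (hopf_rm M)) idfun (coact m).
Proof.
rewrite /= /tmap [LHS]/hat_coact.
rewrite -(coact_assoc (f := fun p q r => tens (tens p q : hat (hopf_rm M)) r));
  [|mlin|mlin].
apply: eq_tlift => m0 m1 /=.
rewrite -[coact m0 in RHS]tlift_tens.
by rewrite (lin_tliftE (g := fun t => tens t m1)) //; mlin.
Qed.

(** B-linearity is the Hopf module axiom, and colinearity is coassociativity of the coaction. *)
Definition coact_hom (M : hopfModType B) : hopf_hom M (hat (hopf_rm M)) :=
  @HopfHom _ _ M (hat (hopf_rm M)) coact (@coact_hat_act M) (@coact_hat_coact M).

End RModules.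

(** * The antipode of a natural projection onto coinvariants *)

Section CoinvProjection.
Variables (K : fieldType) (B : bialgType K).
Variable t : forall M : hopfModType B, {linear M -> M}.
Arguments t : clear implicits.
Hypothesis t_coinv : forall M m, coact (t M m) = tens (t M m) 1.
Hypothesis t_act : forall M m b, t M (ract m b) = counit b *: t M m.
Hypothesis t_id : forall (M : hopfModType B) (m : M),
  coact m = tens m 1 -> t M m = m.
Hypothesis t_natural : forall M N (f : hopf_hom M N) m, t N (f m) = f (t M m).

Section Antipode.
Variable S : {linear B -> B}.
Hypothesis S_def : forall b,
  t (hat (reg_rm B)) (tens (1 : B) b) = tens (S b) (1 : B).

(* Naturality along hat B -> hat V, induced by b |-> vb. *)
Let t_hat (V : rmodule B) (v : V) b :
  t (hat V) (tens v b) = tens (rm_act V v (S b)) 1.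
Proof.
pose f := rm_act V v.
have f_act x c : f (rm_act (reg_rm B) x c) = rm_act V (f x) c.
  exact: rm_actM.
have := t_natural (hat_hom f_act) (tens (1 : B) b).
rewrite /= hat_mapE /= rm_act1 => ->.
by rewrite S_def hat_mapE.
Qed.

(* The coaction is a Hopf module morphism M -> hat M, so t_M is known from t_hat. *)
Let tE (M : hopfModType B) (m : M) :
  t M m = tlift (fun m0 m1 => ract m0 (S m1)) (coact m).
Proof.
apply: (@tens1_inj K B (hopf_rm M)).
rewrite -t_coinv -[LHS](t_natural (coact_hom M)) /=.
rewrite -[coact m in LHS]tlift_tens lin_tliftE; [|mlin|mlin].
rewrite [RHS](lin_tliftE (g := fun t => tens t 1)); [|mlin|mlin].
by apply: eq_tlift => m0 m1; rewrite (t_hat (V := hopf_rm M)).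
Qed.

Lemma antipode_props :
  [/\ right_antipode S, anti_multiplicative S & anti_comultiplicative S].
Proof.
(* The element 1 ⊗ 1 of B ⊗ B is coinvariant, hence fixed by t. *)
have S1 : S 1 = 1.
  apply: (@tens1_inj K B (reg_rm B)).
  rewrite -[S 1]mul1r -(t_hat (V := reg_rm B) 1 1) t_id //.
  by rewrite [LHS]hat_coactE comul1 tliftE //; mlin.
(* This is [tE] at 1 ⊗ b, whose left side is known from [t_hat]. *)
have S_coinv b : tlift (fun b1 b2 => tlift (fun c1 c2 => tens c1 (b1 * c2))
    (comul (S b2))) (comul b) = tens (S b) (1 : B).
  have := tE (tens (1 : B) b : hat (reg_rm B)).
  rewrite t_hat [X in tens X 1]mul1r => ->.
  rewrite [coact _]hat_coactE lin_tliftE; [|mlin|mlin].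
  apply: eq_tlift => b1 b2; rewrite tliftE; last by mlin.
  rewrite [RHS]hat_actE; apply: eq_tlift => c1 c2.
  by rewrite [rm_act _ _ _]mul1r.
(* This is [t_act] at (1 ⊗ b) c = sum c_1 ⊗ b c_2, with [t_hat] evaluating each summand. *)
have S_act b c : tlift (fun c1 c2 => c1 * S (b * c2)) (comul c) = counit c *: S b.
  apply: (@tens1_inj K B (reg_rm B)).
  have := t_act (tens (1 : B) b : hat (reg_rm B)) c.
  rewrite [ract _ _]hat_actE lin_tliftE; [|mlin|mlin].
  rewrite t_hat [X in tens X 1]mul1r.
  rewrite (linZ (f := fun u => tens u (1 : B))); last by mlin.
  move=> <-; rewrite (lin_tliftE (g := fun u => tens u (1 : B))); [|mlin|mlin].
  by apply: eq_tlift => c1 c2; rewrite t_hat -[c1 in LHS]mul1r.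
split.
- exact: right_antipode_of_act.
- exact: anti_multiplicative_of_coinv.
- exact: anti_comultiplicative_of_coinv.
Qed.

End Antipode.

(** The coinvariant t(1 ⊗ b) has the form s ⊗ 1 by [hat_coinv], and [hat_eps] reads off s as
    S(b). *)
Lemma antipode_of_coinv_proj : exists S : {linear B -> B},
  [/\ right_antipode S, anti_multiplicative S & anti_comultiplicative S].
Proof.
pose S0 b : B := hat_eps (t (hat (reg_rm B)) (tens (1 : B) b)).
have S0L : linear S0.
  have eL := @lin_hat_eps K B (reg_rm B).
  by apply: lin_linear; rewrite /S0; mlin.
pose S : {linear B -> B} := HB.pack S0 (GRing.isLinear.Build K B B _ S0 S0L).
exists S; apply: antipode_props => b.
exact: (hat_coinv (t_coinv _)).
Qed.

End CoinvProjection.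

(** * The natural projection given by semiseparability *)

Section CoinvProjectionOfSemiseparable.
Variables (K : fieldType) (B : bialgType K).

(** The left adjoint of the coinvariant functor; [free_unit] and [free_counit] are the unit and
    counit of this adjunction. *)
Let free (V : lmodType K) : hopfModType B := hat (triv_rm B V).

(** The leg c_1 acts on v through eps, so the diagonal action reduces to right multiplication. *)
Lemma free_act (V : lmodType K) (v : V) (b c : B) :
  ract (tens v b : free V) c = tens v (b * c).
Proof.
rewrite [LHS]hat_actE.
rewrite -[RHS](comul_unitl (f := fun c => tens v (b * c))); last by mlin.
apply: eq_tlift => c1 c2.
have -> : rm_act (triv_rm B V) v c1 = counit c1 *: v by [].
by rewrite (linZ (f := fun u => tens u (b * c2))) //; mlin.
Qed.

Lemma free_unit_coinv (V : lmodType K) (v : V) :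
  (tens v (1 : B) : free V) \in coinv_pred (free V).
Proof.
by apply/eqP; rewrite [LHS]hat_coactE comul1 tliftE //; mlin.
Qed.

Definition free_unit (V : lmodType K) (v : V) : coinv (free V) :=
  Coinv (free_unit_coinv v).

Lemma free_unit_linear V : linear (@free_unit V).
Proof. by move=> a x y; apply/val_inj; rewrite /= (lin_tens1 1 (@lin_id _ _)). Qed.

HB.instance Definition _ V :=
  GRing.isLinear.Build K V (coinv (free V)) _ (@free_unit V) (@free_unit_linear V).

Section Counit.
Variable M : hopfModType B.

Definition free_counit (t : free (coinv M)) : M :=
  tlift (fun (v : coinv M) b => ract (val v) b) t.

Lemma free_counit_linear : linear free_counit.
Proof. by apply: lin_linear; rewrite /free_counit; mlin. Qed.

HB.instance Definition _ :=
  GRing.isLinear.Build K (free (coinv M)) M _ free_counit free_counit_linear.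

Lemma free_counitE v b : free_counit (tens v b) = ract (val v) b.
Proof. by rewrite /free_counit tliftE //; mlin. Qed.

Lemma free_counit_act t b : free_counit (ract t b) = ract (free_counit t) b.
Proof.
move: t; apply: tens_ext => [||v c]; [mlin|mlin|].
by rewrite free_act !free_counitE ractM.
Qed.

Lemma free_counit_coact t :
  coact (free_counit t) = tmap free_counit idfun (coact t).
Proof.
rewrite /tmap; move: t; apply: tens_ext => [||v c]; [mlin|mlin|].
rewrite free_counitE coact_act coinvP [coact _ in RHS]hat_coactE.
rewrite lin_tliftE /tmap2; [|mlin|mlin]; rewrite tliftE; last by mlin.
apply: eq_tlift => b1 b2; rewrite tliftE; last by mlin.
by rewrite free_counitE mul1r.
Qed.

Definition free_counit_hom : hopf_hom (free (coinv M)) M :=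
  HopfHom free_counit_act free_counit_coact.

End Counit.

Section FreeMap.
Variables (U V : lmodType K) (f : {linear U -> V}).

Lemma free_map_act u b :
  f (rm_act (triv_rm B U) u b) = rm_act (triv_rm B V) (f u) b.
Proof. exact: linearZ. Qed.

Definition free_map : hopf_hom (free U) (free V) :=
  @hat_hom K B (triv_rm B U) (triv_rm B V) f free_map_act.
End FreeMap.

Variable P :
  nat_trans (hom_functor_along (coinv_functor B)) (hom_functor (hopf_cat B)).
Hypothesis PE :
  nt_comp (fmap_nt (coinv_functor B)) (nt_comp P (fmap_nt (coinv_functor B))) =
  fmap_nt (coinv_functor B).

Let lift (M N : hopfModType B) (g : {linear coinv M -> coinv N}) : hopf_hom M N :=
  P ((M : op_cat (hopf_cat B)), (N : hopf_cat B)) g.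

Let lift_natural (M M' N N' : hopfModType B) (f : hopf_hom M' M)
    (h : hopf_hom N N')
    (g : {linear coinv M -> coinv N}) m :
  lift (coinv_map h \o (g \o coinv_map f)) m = h (lift g (f m)).
Proof.
have := @nt_natural _ _ _ _ P ((M : op_cat (hopf_cat B)), (N : hopf_cat B))
  ((M' : op_cat (hopf_cat B)), (N' : hopf_cat B)) (f, h).
by move=> /(congr1 (fun F => F g)) /(congr1 (fun F : hopf_hom _ _ => F m)).
Qed.

(** Semiseparability controls [lift g] only when g is induced by a Hopf module morphism; the
    identity is the instance that [proj_id] requires. *)
Let lift_id (M : hopfModType B) (m : coinv M) :
  lift (M := M) (N := M) idfun (val m) = val m.
Proof.
have := congr1 (fun s : nat_trans (hom_functor (hopf_cat B))
    (hom_functor_along (coinv_functor B)) =>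
  s ((M : op_cat (hopf_cat B)), (M : hopf_cat B)) (hopf_id M)) PE.
move=> /(congr1 (fun F : {linear coinv M -> coinv M} => val (F m))) /=.
have e : coinv_map (hopf_id M) = idfun :> {linear coinv M -> coinv M}.
  exact: fmap1 (coinv_functor B) M.
by rewrite [X in P _ X]e.
Qed.

Let gamma (M : hopfModType B) : hopf_hom M (free (coinv M)) :=
  lift (@free_unit (coinv M)).

Let proj (M : hopfModType B) (m : M) : M := val (hat_eps (gamma M m)).

Let proj_linear (M : hopfModType B) : linear (@proj M).
Proof.
have eL := @lin_hat_eps K B (triv_rm B (coinv M)).
by apply: lin_linear; rewrite /proj; mlin.
Qed.

Let proj_coinv (M : hopfModType B) (m : M) : coact (proj m) = tens (proj m) 1.
Proof. exact: coinvP. Qed.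

Let proj_act (M : hopfModType B) (m : M) b :
  proj (ract m b) = counit b *: proj m.
Proof.
rewrite /proj hopf_act; move: (gamma M m) => t.
have eL := @lin_hat_eps K B (triv_rm B (coinv M)).
suff -> : hat_eps (ract t b) = counit b *: hat_eps t by [].
move: t; apply: tens_ext => [||v c]; [mlin|mlin|].
by rewrite free_act !hat_epsE counitM scalerA mulrC.
Qed.

(** The image of m under [gamma] is coinvariant, hence equal to p ⊗ 1, and [free_counit] sends it to
    [proj m]. Naturality moves [free_counit] inside [lift], where a triangle identity leaves the
    lift of the identity, which fixes m. *)
Let proj_id (M : hopfModType B) (m : M) : coact m = tens m 1 -> proj m = m.
Proof.
move=> mC; have mC' : m \in coinv_pred M by apply/eqP.
have gC : coact (gamma M m) = tens (gamma M m) 1.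
  by rewrite hopf_coact mC (tmapE (linearP _) (linearP idfun)).
have := lift_natural (hopf_id M) (free_counit_hom M) (@free_unit (coinv M)) m.
rewrite /= -/(gamma M) (hat_coinv gC).
rewrite free_counitE ract1 -/(proj m) => <-.
have -> : coinv_map (free_counit_hom M) \o
    (@free_unit (coinv M) \o coinv_map (hopf_id M)) =
    idfun :> {linear coinv M -> coinv M}.
  by apply: linear_ext => x; apply/val_inj; rewrite /= free_counitE ract1.
exact: (lift_id (Coinv mC')).
Qed.

(** Naturality of [gamma] suffices: by [lift_natural] both composites are the lift of the same map v
    |-> f(v) ⊗ 1 on coinvariants. *)
Let proj_natural (M N : hopfModType B) (f : hopf_hom M N) m :
  proj (f m) = f (proj m).
Proof.
have eLM := @lin_hat_eps K B (triv_rm B (coinv M)).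
have eLN := @lin_hat_eps K B (triv_rm B (coinv N)).
rewrite /proj; have -> : gamma N (f m) = free_map (coinv_map f) (gamma M m).
  have h1 := lift_natural f (hopf_id (free (coinv N))) (@free_unit (coinv N)) m.
  have h2 := lift_natural (hopf_id M) (free_map (coinv_map f)) (@free_unit (coinv M)) m.
  rewrite -[LHS]h1 -[RHS]h2; congr (hopf_fun (lift _) m).
  apply: linear_ext => x; apply/val_inj => /=.
  have -> : coinv_map (hopf_id M) x = x by exact: val_inj.
  by rewrite hat_mapE.
move: (gamma M m); apply: tens_ext => [||v b]; [mlin|mlin|].
by rewrite /= hat_mapE !hat_epsE /= linearZ.
Qed.

Lemma antipode_of_semiseparable : exists S : {linear B -> B},
  [/\ right_antipode S, anti_multiplicative S & anti_comultiplicative S].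
Proof.
pose t (M : hopfModType B) : {linear M -> M} :=
  HB.pack (@proj M)
    (GRing.isLinear.Build K M M _ (@proj M) (@proj_linear M)).
apply: (@antipode_of_coinv_proj K B t).
- exact: proj_coinv.
- exact: proj_act.
- exact: proj_id.
- exact: proj_natural.
Qed.

End CoinvProjectionOfSemiseparable.

Theorem theorem3p30 (K : fieldType) (B : bialgType K) :
  [<-> semiseparable (coinv_functor B);
       exists S : {linear B -> B},
         [/\ right_antipode S, anti_multiplicative S & anti_comultiplicative S];
       nt_invertible (sigma B);
       nt_split_mono (sigma B)].
Proof.
tfae.
- by case=> P PE; exact: antipode_of_semiseparable PE.
- by case=> S [SP SM SC]; exact: sigma_invertible SP SM SC.
- by case=> t [ts _]; exists t.
- by case=> t ts; exact: semiseparable_of_split ts.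
Qed.
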